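(* Let $\chi$ be a finite or countable alphabet, let $\mu,\nu$ be probability measures on $\chi^{\mathbb{N}}$, and let $g\ge 0$ be a fixed integer. Suppose there exist constants $K>0$ and $\epsilon>0$ such that for all integers $i,j\ge 1$ $$\log \psi_g^+(i,j)\le K\,\frac{i+j}{[\log(i+j)]^{1+\epsilon}} .$$ Then the limiting rate $$\mathcal{R}=\lim_{k\to\infty}\left(-\frac1k\log \mathbb{E}_{\mu,\nu}(k)\right)$$ exists (as an element of $[0,\infty]$), i.e. $\liminf_{k\to\infty}\left(-\frac1k\log \mathbb{E}_{\mu,\nu}(k)\right)=\limsup_{k\to\infty}\left(-\frac1k\log \mathbb{E}_{\mu,\nu}(k)\right)$.
   Context: $\sigma$ is the left shift on $\chi^{\mathbb{N}}$, $\mathbb{N}=\{0,1,2,\dots\}$. A string $\omega\in\chi^k$ is identified with the cylinder $\{\mathbf{x}\in\chi^{\mathbb{N}}: x_0\cdots x_{k-1}=\omega\}$, and $\mu(\omega)$ denotes its measure; $\mu\nu(\omega)$ means $\mu(\omega)\nu(\omega)$. The $k$-divergence is $\mathbb{E}_{\mu,\nu}(k)=\sum_{\omega\in\chi^k}\mu\nu(\omega)$; the convention $-\log 0=+\infty$ is used. For the measure $\mu$ set $$\psi_{\mu,g}^+(i,j)=\sup_{\omega\in\chi^i,\ \xi\in\chi^j}\frac{\mu(\sigma^{-(i+g)}\xi\mid\omega)}{\mu(\xi)},$$ where $\mu(\cdot\mid\omega)$ is the conditional probability given the cylinder $\omega$; the supremum is over $\omega$ with $\mu(\omega)>0$, a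 ratio $c/0$ with $c>0$ is $+\infty$, and ratios $0/0$ are ignored. Define $\psi_{\nu,g}^+$ in the same way, and $\psi_g^+(i,j)=\max\{\psi_{\mu,g}^+(i,j),\psi_{\nu,g}^+(i,j)\}$. Logarithms are in any fixed base larger than $1$. *)

(* Defs.v *)
From HB Require Import structures.
From mathcomp Require Import all_boot all_order all_algebra.
From mathcomp Require Import all_classical all_reals all_analysis.

Set Implicit Arguments.
Unset Strict Implicit.
Unset Printing Implicit Defensive.

Import Order.TTheory GRing.Theory Num.Theory.
Import numFieldNormedType.Exports.

Local Open Scope classical_set_scope.
Local Open Scope ring_scope.
Local Open Scope ereal_scope.

(* The alphabet is a [pointedType] because the library's measurable types are
   pointed; nonemptiness is automatic as soon as a probability on the sequence
   space exists. Countability of the alphabet is a hypothesis of the theorem. *)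

Definition seq_shift {X : Type} (x : nat -> X) : nat -> X := fun n => x n.+1.

Definition cylinder {X : Type} {k : nat} (w : k.-tuple X) : set (nat -> X) :=
  [set x | forall m : 'I_k, x m = tnth w m].

Definition cylinders (X : Type) : set (set (nat -> X)) :=
  [set C | exists k (w : k.-tuple X), C = cylinder w].

(* Over a countable alphabet this is the product of the discrete
   sigma-algebras. *)
Definition seq_space (X : pointedType) := g_sigma_algebraType (@cylinders X).

Section Divergence.
Context {X : pointedType} {R : realType}.
Implicit Types mu nu : probability (seq_space X) R.

(* The quotient of extended reals is a junk value when mu (cylinder w) = 0;
   [psi_plus] only uses it when mu (cylinder w) > 0. *)
Definition cond_cyl mu (A : set (nat -> X)) (i : nat) (w : i.-tuple X)
    : \bar R :=
  mu (A `&` cylinder w) / mu (cylinder w).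

(* In \bar R, c / 0 = +oo for c > 0; the last condition on (w, xi) discards the
   ratios 0 / 0. *)
Definition psi_plus mu (g i j : nat) : \bar R :=
  ereal_sup [set r | exists (w : i.-tuple X) (xi : j.-tuple X),
    let c := cond_cyl mu (iter (i + g) seq_shift @^-1` cylinder xi) w in
    [/\ 0 < mu (cylinder w),
        ~ (c = 0 /\ mu (cylinder xi) = 0) &
        r = c / mu (cylinder xi)]].

Definition psi_plus_max mu nu (g i j : nat) : \bar R :=
  maxe (psi_plus mu g i j) (psi_plus nu g i j).

Definition divergence mu nu (k : nat) : \bar R :=
  \esum_(w in [set: k.-tuple X]) (mu (cylinder w) * nu (cylinder w)).

End Divergence.

(* Logarithms in base b > 1. *)
Definition logb {R : realType} (b x : R) : R := (ln x / ln b)%R.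

(* Extended with loge b 0 = -oo and loge b +oo = +oo. *)
Definition loge {R : realType} (b : R) (x : \bar R) : \bar R :=
  lne x * ((ln b)^-1)%:E.

(* The term k = 0 is irrelevant for the limit k -> oo. *)
Definition rate {X : pointedType} {R : realType} (b : R)
    (mu nu : probability (seq_space X) R) (k : nat) : \bar R :=
  - ((k%:R^-1)%:E * loge b (divergence mu nu k)).

(* Main.v *)
(* Write E(k) for the k-divergence. Bounding the sum over the gap word of a
   product of two measures by the product of the two sums, and then using psi,
   gives E(i + g + j) <= psi_mu psi_nu E(i) E(j); moreover E is nonincreasing.
   Hence a(k) = log E(k) satisfies
     a(i + g + j) <= a(i) + a(j) + K' n / (log n)^(1 + eps),   n = i + j.
   Since the sum of 1 / (n (log n)^(1 + eps)) converges, this is subadditivity up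
   to a negligible error (de Bruijn-Erdos): for suitable C,
     d(n) = a(n - g) + C n / (log n)^eps
   satisfies d(x + y) <= d(x) + d(y) for large x, y within a factor 2 of each
   other. Repeated halving gives d(q M) <= q d(M), so every value of the rate
   that is exceeded for arbitrarily large M is, up to an arbitrarily small loss,
   eventually exceeded. If E vanishes somewhere, the rate is eventually +oo. *)
Require Import Defs.
From HB Require Import structures.
From mathcomp Require Import all_boot all_order all_algebra.
From mathcomp Require Import all_classical all_reals all_analysis.
From mathcomp Require Import lra ring zify.

Set Implicit Arguments.
Unset Strict Implicit.
Unset Printing Implicit Defensive.

Import Order.TTheory GRing.Theory Num.Theory.
Import numFieldNormedType.Exports.

Local Open Scope classical_set_scope.
Local Open Scope ring_scope.

(** * Real sequences that are subadditive up to a gap and a logarithmic error *)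

Section almost_subadditive.
Context {R : realType}.
Implicit Types (e l x y : R) (a d : nat -> R).

(* The derivative bound for [t |-> t `^ (- e)], obtained without calculus from
   [1 + t <= expR t] and [ln (1 + t) <= t]. *)
Lemma powRN_diff_ge e l x : 0 < e -> 0 < l -> l <= x ->
  e * (x - l) * x `^ (- (1 + e)) <= l `^ (- e) - x `^ (- e).
Proof.
move=> e0 l0 lx; have x0 : 0 < x by exact: lt_le_trans lx.
have xn0 : x != 0 by rewrite gt_eqF.
have -> : l `^ (- e) = x `^ (- e) * expR (e * (ln x - ln l)).
  by rewrite /powR !gt_eqF// -expRD; congr expR; ring.
have lnxl : (x - l) / x <= ln x - ln l.
  have : ln (1 + (l / x - 1)) <= l / x - 1.
    by apply: le_ln1Dx; rewrite ltrBrDl subrr divr_gt0.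
  by rewrite subrKC ln_div ?posrE// mulrBl divff//; lra.
have : 1 + e * ((x - l) / x) <= expR (e * (ln x - ln l)).
  by apply: le_trans (expR_ge1Dx _); rewrite lerD2l ler_pM2l.
move=> /(ler_wpM2l (powR_ge0 x (- e))).
have -> : x `^ (- (1 + e)) = x `^ (- e) / x.
  by rewrite opprD addrC powRD ?xn0 ?implybT// powR_inv1// ltW.
by move: (expR _) (powR _ _) => E P; rewrite mulrDr mulr1; lra.
Qed.

Lemma exists_nat_ge x : exists n : nat, x <= n%:R.
Proof. by exists (Num.truncn x).+1; exact: ltW (truncnS_gt x). Qed.

(* Serves as the correction term: [C * xlogN e] turns the almost subadditive
   sequence of logarithms into one that is subadditive for arguments within a
   factor 2 of each other; its ratio to [x] tends to 0. *)
Definition xlogN e x := x * (ln x) `^ (- e).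

(** As [x] and [y] are within a factor 2 of each other, each is at most two thirds of the sum, so
    passing to the sum raises the logarithm by at least [ln (3 / 2)]. By [powRN_diff_ge] this yields
    a gain of the same shape as the error term. *)
Lemma xlogN_superadditive e x y : 0 < e -> 1 < x -> 1 < y ->
  x <= 2 * y -> y <= 2 * x ->
  e * ln (3 / 2) * ((x + y) * ln (x + y) `^ (- (1 + e))) <=
  xlogN e x + xlogN e y - xlogN e (x + y).
Proof.
move=> e0 x1 y1 xy yx; set s := x + y.
have s0 : 0 < s by rewrite /s; lra.
have increment z : 1 < z -> 3 / 2 * z <= s ->
    e * ln (3 / 2) * ln s `^ (- (1 + e)) <= ln z `^ (- e) - ln s `^ (- e).
  move=> z1 zs.
  have lnzs : ln (3 / 2) + ln z <= ln s.
    by rewrite -lnM ?posrE ?ler_ln ?posrE//; nra.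
  have ln32 : 0 < ln (3 / 2) :> R by apply: ln_gt0; lra.
  apply: le_trans (powRN_diff_ge e0 (ln_gt0 z1) (_ : ln z <= ln s)); last lra.
  by rewrite ler_wpM2r ?powR_ge0// ler_pM2l//; lra.
have hx := increment x x1 ltac:(rewrite /s; lra).
have hy := increment y y1 ltac:(rewrite /s; lra).
have -> : xlogN e x + xlogN e y - xlogN e s =
    x * (ln x `^ (- e) - ln s `^ (- e)) + y * (ln y `^ (- e) - ln s `^ (- e)).
  by rewrite /xlogN [in X in _ - X]/s; ring.
have -> : e * ln (3 / 2) * (s * ln s `^ (- (1 + e))) =
    x * (e * ln (3 / 2) * ln s `^ (- (1 + e))) +
    y * (e * ln (3 / 2) * ln s `^ (- (1 + e))).
  by rewrite {1}/s; ring.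
by rewrite lerD// ler_pM2l//; lra.
Qed.

Lemma balanced_subadditive_muln d (N M q : nat) :
  (forall i j, (N <= i)%N -> (N <= j)%N -> (i <= 2 * j)%N -> (j <= 2 * i)%N ->
    d (i + j)%N <= d i + d j) ->
  (N <= M)%N -> (0 < q)%N -> d (q * M)%N <= q%:R * d M.
Proof.
move=> dsub NM; (* split [q] into its two halves, which differ by at most 1 *)
elim/ltn_ind: q => -[//|[|q]] IH _; first by rewrite mul1n mul1r.
have -> : q.+2 = (q.+2./2 + uphalf q.+2)%N by lia.
have h1 : (0 < q.+2./2 < q.+2)%N by lia.
have h2 : (0 < uphalf q.+2 < q.+2)%N by lia.
rewrite mulnDl natrD mulrDl.
apply: le_trans (dsub _ _ _ _ _ _) (lerD (IH _ _ _) (IH _ _ _)); try nia.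
Qed.

Lemma ln_powN_small e (eta : R) : 0 < e -> 0 < eta ->
  exists N, forall n, (N <= n)%N -> ln n%:R `^ (- e) <= eta.
Proof.
(* The threshold is the point where the power of the logarithm equals [eta]. *)
move=> e0 eta0; have [N NP] := exists_nat_ge (expR (eta `^ (- e^-1))); exists N => n nN.
have {NP}nP : expR (eta `^ (- e^-1)) <= n%:R.
  by apply: le_trans NP _; rewrite ler_nat.
have n0 : 0 < n%:R :> R by apply: lt_le_trans nP; exact: expR_gt0.
have lnn : eta `^ (- e^-1) <= ln n%:R.
  by rewrite -ler_expR lnK ?posrE.
have L0 : 0 < eta `^ (- e^-1) by exact: powR_gt0.
have -> : eta = (eta `^ (- e^-1)) `^ (- e).
  by rewrite -powRrM mulrNN mulVf ?gt_eqF// powRr1// ltW.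
have lnn0 := lt_le_trans L0 lnn.
rewrite !(powRN _ e) lef_pV2 ?posrE ?powR_gt0//.
by apply: ge0_ler_powR; rewrite ?nnegrE// ltW.
Qed.

(** The gain from [xlogN_superadditive] pays for the error of every splitting, so [q] blocks of
    length [m + g] can be joined at the price of one correction per block. *)
Lemma gapped_block_bound a g e (K : R) : 0 < e -> 0 <= K ->
  {homo a : m n / (m <= n)%N >-> n <= m} ->
  (forall i j, (1 <= i)%N -> (1 <= j)%N ->
    a (i + (g + j))%N <=
      a i + a j + K * ((i + j)%:R * ln (i + j)%:R `^ (- (1 + e)))) ->
  exists2 C, 0 <= C & exists N, forall m q, (N <= m)%N -> (0 < q)%N ->
    a (q * (m + g))%N <= q%:R * (a m + C * xlogN e (m + g)%:R).
Proof.
move=> e0 K0 amono asub.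
have ln32 : 0 < ln (3 / 2) :> R by apply: ln_gt0; lra.
(* The divisor is the constant gained in [xlogN_superadditive]; the power of 2 pays for replacing
   [ln (x + y - 2 * g)] by [ln (x + y)], which is at most twice as large. *)
pose C := K * 2 `^ (1 + e) / (e * ln (3 / 2)).
have C0 : 0 <= C by rewrite divr_ge0 ?mulr_ge0 ?powR_ge0// ltW.
exists C => //; exists (3 * g + 2)%N => m q mN q0.
(* the shift by [g] absorbs the gap into the block length *)
pose d n := a (n - g)%N + C * xlogN e n%:R.
apply: (@le_trans _ _ (d (q * (m + g))%N)).
  rewrite /d -[leLHS]addr0 lerD//; first by apply: amono; lia.
  by apply: (mulr_ge0 C0); exact: mulr_ge0 (ler0n _ _) (powR_ge0 _ _).
have -> : a m + C * xlogN e (m + g)%:R = d (m + g)%N by rewrite /d addnK.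
apply: (@balanced_subadditive_muln d (3 * g + 2)) => //; last by lia.
move=> x y xN yN xy yx; rewrite /d.
have sub : a (x + y - g)%N <= a (x - g)%N + a (y - g)%N +
    K * ((x + y - 2 * g)%:R * ln (x + y - 2 * g)%:R `^ (- (1 + e))).
  have -> : (x + y - g = (x - g) + (g + (y - g)))%N by lia.
  have -> : (x + y - 2 * g = (x - g) + (y - g))%N by lia.
  by apply: asub; lia.
have := @xlogN_superadditive e x%:R y%:R e0.
rewrite -natrD -!natrM !ltr1n !ler_nat => /(_ ltac:(lia) ltac:(lia) xy yx) sup.
have := ler_wpM2l C0 sup.
set n := (x + y - 2 * g)%N in sub *; set s := (x + y)%N in sub sup *.
(* Since [x] and [y] are at least [3 * g + 2], [s <= 2 * n <= n ^ 2]. *)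
have lnns : ln s%:R <= 2 * ln n%:R :> R.
  rewrite -ln_powR ler_ln ?posrE ?powR_gt0 ?ltr0n; try by rewrite /s /n; lia.
  rewrite powR_mulrn// -natrX ler_nat.
  apply: (@leq_trans (2 * n)); first by rewrite /s /n; lia.
  by rewrite -mulnn leq_mul2r; apply/orP; right; rewrite /n; lia.
have ln_s0 : 0 < ln s%:R :> R by apply: ln_gt0; rewrite ltr1n /s; lia.
have n_le_s : n%:R * ln n%:R `^ (- (1 + e)) <=
    2 `^ (1 + e) * (s%:R * ln s%:R `^ (- (1 + e))) :> R.
  rewrite mulrCA ler_pM ?powR_ge0// ?ler_nat; first by rewrite /n /s; lia.
  have -> : 2 `^ (1 + e) * ln s%:R `^ (- (1 + e)) =
     (ln s%:R / 2) `^ (- (1 + e)) :> R.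
    rewrite powRM ?invr_ge0// ?ltW// [RHS]mulrC; congr (_ * _).
    by rewrite -powR_inv1// -powRrM mulrNN mul1r.
  rewrite !(powRN _ (1 + e)) lef_pV2 ?posrE ?powR_gt0//; try lra.
  by apply: ge0_ler_powR; rewrite ?nnegrE; lra.
have -> : C * (e * ln (3 / 2) * (s%:R * ln s%:R `^ (- (1 + e)))) =
    K * (2 `^ (1 + e) * (s%:R * ln s%:R `^ (- (1 + e)))).
  by rewrite /C; field; rewrite !gt_eqF.
move: (ler_wpM2l K0 n_le_s).
by lra.
Qed.

(** A single long block with rate at least [c'] suffices: repeating it controls the multiples of
    [M], and monotonicity of [a] controls the lengths in between. *)
Lemma gapped_rate_persists a g e (K c c' : R) : 0 < e -> 0 <= K ->
  {homo a : m n / (m <= n)%N >-> n <= m} -> (forall n, a n <= 0) ->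
  (forall i j, (1 <= i)%N -> (1 <= j)%N ->
    a (i + (g + j))%N <=
      a i + a j + K * ((i + j)%:R * ln (i + j)%:R `^ (- (1 + e)))) ->
  c < c' ->
  (forall N, exists2 m, (N <= m)%N & c' <= - (m%:R^-1 * a m)) ->
  \forall k \near \oo, c <= - (k%:R^-1 * a k).
Proof.
move=> e0 K0 amono a0 asub cc' freq.
(* For negative [c] the sign of [a] is enough; afterwards [0 <= c] makes the factor [c + 2 * eta]
   nonnegative. *)
have [cneg|c0] := ltP c 0.
  apply: nearW => k; apply: le_trans (ltW cneg) _.
  by rewrite oppr_ge0 mulr_ge0_le0.
have [C C0 [N block]] := gapped_block_bound e0 K0 amono asub.
(* The margin is cut into four shares: one each for the gap, the correction and the incomplete last
   block, and one to spare. *)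
pose eta := (c' - c) / 4.
have eta0 : 0 < eta by rewrite /eta; lra.
(* Dividing by [C + 1] instead of [C] covers the case [C = 0]. *)
have [N1 small] := ln_powN_small e0 (divr_gt0 eta0 (ltr_wpDl C0 ltr01)).
have [N2 N2P] := exists_nat_ge (c' * g%:R / eta).
have [m mN mc'] := freq (N + N1 + N2 + 1)%N.
have [Nm N1m N2m mgt0] : [/\ N <= m, N1 <= m, N2 <= m & 0 < m]%N.
  by clear -mN; split; lia.
set M := (m + g)%N; have mM : (m <= M)%N by exact: leq_addr.
have m0 : 0 < m%:R :> R by rewrite ltr0n.
have gM : c' * g%:R <= eta * M%:R.
  rewrite [leRHS]mulrC -ler_pdivrMr//.
  by apply: le_trans N2P _; rewrite ler_nat (leq_trans N2m).
have Csmall : C * xlogN e M%:R <= eta * M%:R.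
  have := small M (leq_trans N1m mM); rewrite /xlogN.
  have := powR_ge0 (ln M%:R) (- e); move: (_ `^ _) => P P0.
  rewrite ler_pdivlMr; last lra.
  by move=> PC; rewrite mulrCA [leRHS]mulrC ler_wpM2l//; lra.
have blockM : a m + C * xlogN e M%:R <= - ((c + 2 * eta) * M%:R).
  have am : a m <= - (c' * m%:R).
    by move: mc'; rewrite mulrC -mulNr ler_pdivlMr// lerNr.
  have mE : m%:R = M%:R - g%:R :> R by rewrite /M natrD addrK.
  have c'M : c' * M%:R = (c + 4 * eta) * M%:R by congr (_ * _); rewrite /eta; lra.
  move: am Csmall gM c'M; rewrite mE mulrBr.
  move: (a m) (C * _) (c' * _) (c' * _) => *; lra.
have [N3 N3P] := exists_nat_ge (c' * M%:R / eta).
exists (M + N3)%N => // k /= kM.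
have M0 : (0 < M)%N by exact: leq_trans mM.
have [Mk N3k] : (M <= k /\ N3 <= k)%N by clear -kM; lia.
have k0 : 0 < k%:R :> R by rewrite ltr0n (leq_trans M0).
have q0 : (0 < k %/ M)%N by rewrite divn_gt0.
have ak : a k <= a (k %/ M * M)%N by apply: amono; exact: leq_trunc_div.
have := block m (k %/ M)%N Nm q0; rewrite -/M => bl.
rewrite lerNr mulrC ler_pdivrMr//.
apply: le_trans ak (le_trans bl _).
apply: le_trans (ler_wpM2l _ blockM) _ => //.
have kq : k%:R - M%:R <= (k %/ M)%:R * M%:R :> R.
  rewrite lerBlDr -natrM -natrD ler_nat {1}(divn_eq k M) leq_add2l.
  by rewrite ltnW// ltn_pmod.
have kbig : c' * M%:R <= eta * k%:R.
  rewrite [leRHS]mulrC -ler_pdivrMr//.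
  by apply: le_trans N3P _; rewrite ler_nat.
have -> : (k %/ M)%:R * - ((c + 2 * eta) * M%:R) =
   - ((c + 2 * eta) * ((k %/ M)%:R * M%:R)) by ring.
have c2eta : 0 <= c + 2 * eta by lra.
have c2eta_M : (c + 2 * eta) * M%:R <= c' * M%:R.
  by rewrite ler_wpM2r// /eta; lra.
have etak : 0 <= eta * k%:R by rewrite mulr_ge0// ltW.
have := ler_wpM2l c2eta kq; rewrite mulrBr.
move: (_ * (_ * M%:R)) c2eta_M kbig => T.
by move=> *; lra.
Qed.

End almost_subadditive.

Local Open Scope ereal_scope.

(** * Countability of the set of words and sums over words *)

Lemma countable_tuple (X : Type) (n : nat) :
  countable [set: X] -> countable [set: n.-tuple X].
Proof.
move=> /countable_injP[f finj]; apply/countable_injP.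
exists (fun t => choice.pickle [seq f x | x <- t]) => s t _ _.
move=> /(pcan_inj choice.pickleK)/inj_map e; apply/val_inj/e.
by move=> x y; apply: finj; rewrite inE.
Qed.

Section esum_bounds.
Context {R : realType}.

Lemma esum_mulr_le (T : choiceType) (D : set T) (f : T -> \bar R) (c : \bar R) :
  (forall t, 0 <= f t) -> 0 <= c ->
  \esum_(t in D) (f t * c) <= (\esum_(t in D) f t) * c.
Proof.
move=> f0 c0; apply: ge_ereal_sup => _ [S SD <-].
rewrite -ge0_mule_fsuml//; apply: lee_wpmul2r => //.
by apply: ereal_sup_ubound; exists S.
Qed.

Lemma esum_measure_le d (T : measurableType d) (m : {measure set T -> \bar R})
    (I : choiceType) (F : I -> set T) (A : set T) :
  (forall i, measurable (F i)) -> trivIset setT F -> measurable A ->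
  (forall i, F i `<=` A) -> \esum_(i in [set: I]) m (F i) <= m A.
Proof.
move=> mF tF mA FA; apply: ge_ereal_sup => _ [S [finS _] <-].
rewrite -measure_fin_bigcup//; last exact: sub_trivIset tF.
apply: le_measure; rewrite ?inE//; last exact: bigcup_sub.
by apply: fin_bigcup_measurable => // i _; exact: mF.
Qed.

(** Bounding the second factor by [m2 A] leaves a sum of measures of disjoint subsets of [A]. This
    is what removes the sum over gap words. *)
Lemma esum_measureM_le d (T : measurableType d)
    (m1 m2 : {measure set T -> \bar R})
    (I : choiceType) (F : I -> set T) (A : set T) :
  (forall i, measurable (F i)) -> trivIset setT F -> measurable A ->
  (forall i, F i `<=` A) ->
  \esum_(i in [set: I]) (m1 (F i) * m2 (F i)) <= m1 A * m2 A.
Proof.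
move=> mF tF mA FA.
apply: (@le_trans _ _ (\esum_(i in [set: I]) (m1 (F i) * m2 A))).
  apply: le_esum => i _; apply: lee_wpmul2l => //.
  by apply: le_measure; rewrite ?inE//; exact: FA.
apply: le_trans (esum_mulr_le _ _ _) _ => //.
by apply: lee_wpmul2r => //; exact: esum_measure_le.
Qed.

Lemma esum_tuple_cat (X : choiceType) (i j : nat)
    (a : (i + j).-tuple X -> \bar R) : (forall t, 0 <= a t) ->
  \esum_(t in [set: (i + j).-tuple X]) a t =
  \esum_(w in [set: i.-tuple X]) \esum_(v in [set: j.-tuple X])
    a (cat_tuple w v).
Proof.
move=> a0; rewrite esum_esum//.
rewrite (reindex_esum ([set: i.-tuple X] `*`` fun=> [set: j.-tuple X]) _
  (fun p => cat_tuple p.1 p.2))//.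
split => // [[w v] [w' v'] _ _ /= /(congr1 val)/= /eqP|t _].
  rewrite eqseq_cat ?size_tuple// => /andP[/eqP ew /eqP ev].
  by congr (_, _); apply: val_inj.
have st : size (take i t) = i by rewrite size_takel// size_tuple leq_addr.
have sd : size (drop i t) = j by rewrite size_drop size_tuple addKn.
exists (tcast st (in_tuple (take i t)), tcast sd (in_tuple (drop i t))) => //.
by apply: val_inj; rewrite /= !val_tcast /= cat_take_drop.
Qed.

Lemma esum_exchange (S T : choiceType) (a : S -> T -> \bar R) :
  (forall s t, 0 <= a s t) ->
  \esum_(s in [set: S]) \esum_(t in [set: T]) a s t =
  \esum_(t in [set: T]) \esum_(s in [set: S]) a s t.
Proof.
move=> a0; rewrite !esum_esum//.
rewrite (reindex_esum ([set: T] `*`` fun=> [set: S]) _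
  (fun p => (p.2, p.1)))//.
by split => // [[s t] [s' t'] _ _ [-> ->]//|[s t] _]; exists (t, s).
Qed.

End esum_bounds.

(** * Cylinders and the shift *)

Lemma iter_seq_shift (X : Type) (n : nat) (x : nat -> X) (m : nat) :
  iter n seq_shift x m = x (n + m)%N.
Proof. by elim: n m => //= n IH m; rewrite /seq_shift IH addnS. Qed.

Lemma cylinder_cat (X : Type) (i j : nat) (w : i.-tuple X) (v : j.-tuple X) :
  cylinder (cat_tuple w v) =
  cylinder w `&` (iter i seq_shift @^-1` cylinder v).
Proof.
apply/seteqP; split => x /=.
  move=> xwv; split => m.
    by rewrite -(tnth_lshift w v) -xwv.
  by rewrite iter_seq_shift -(tnth_rshift w v) -xwv.
move=> [xw xv] m; case: (split_ordP m) => k ->.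
  by rewrite tnth_lshift -xw.
by rewrite tnth_rshift -xv iter_seq_shift.
Qed.

Lemma cylinder_inj (X : Type) (k : nat) (w v : k.-tuple X) (x : nat -> X) :
  cylinder w x -> cylinder v x -> w = v.
Proof. by move=> xw xv; apply: eq_from_tnth => m; rewrite -xw -xv. Qed.

(** * Monotonicity and the gap inequality for the divergence *)

Section Divergence.
Context {X : pointedType} {R : realType}.
Implicit Types mu nu : probability (seq_space X) R.

Lemma measurable_cylinder (k : nat) (w : k.-tuple X) :
  measurable (cylinder w : set (seq_space X)).
Proof. by apply: sub_sigma_algebra; exists k, w. Qed.
#[local] Hint Resolve measurable_cylinder : core.

(** The preimage is the union of the cylinders of all [n]-letter prefixes followed by [w], a
    countable union because the alphabet is countable. *)
Lemma measurable_shift_cylinder (n k : nat) (w : k.-tuple X) :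
  countable [set: X] ->
  measurable (iter n seq_shift @^-1` cylinder w : set (seq_space X)).
Proof.
move=> cX.
have -> : (iter n seq_shift @^-1` cylinder w : set (seq_space X)) =
    \bigcup_(v : n.-tuple X) cylinder (cat_tuple v w).
  apply/seteqP; split => x /=; last by move=> [v _]; rewrite cylinder_cat => -[].
  move=> xw; exists [tuple x i | i < n] => //.
  by rewrite cylinder_cat; split => // m; rewrite tnth_mktuple.
by apply: countable_bigcupT_measurable => //; exact: countable_tuple.
Qed.

Lemma divergence_ge0 mu nu k : 0 <= divergence mu nu k.
Proof. by apply: esum_ge0 => w _; exact: mule_ge0. Qed.

Lemma divergence_le1 mu nu k : divergence mu nu k <= 1.
Proof.
rewrite -[leRHS]mule1 -{1}(@probability_setT _ _ _ mu) -(@probability_setT _ _ _ nu).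
apply: esum_measureM_le => //.
by move=> w v _ _ [x [xw xv]]; exact: cylinder_inj xw xv.
Qed.

(** The words extending [w] have disjoint cylinders inside that of [w]. *)
Lemma divergence_addn_le mu nu k n :
  divergence mu nu (k + n) <= divergence mu nu k.
Proof.
rewrite /divergence esum_tuple_cat; last by move=> t; exact: mule_ge0.
apply: le_esum => w _; apply: esum_measureM_le => //.
  move=> v v' _ _ [x []]; rewrite !cylinder_cat => -[_ xv] [_ xv'].
  exact: cylinder_inj xv xv'.
by move=> v; rewrite cylinder_cat; exact: subIsetl.
Qed.

(** This clears the denominators in [psi_plus]; the care goes into null cylinders, where the
    quotients degenerate. *)
Lemma psi_plus_bound mu g i j (w : i.-tuple X) (xi : j.-tuple X) (C : R) :
  countable [set: X] -> (0 <= C)%R -> psi_plus mu g i j <= C%:E ->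
  mu (cylinder w `&` (iter (i + g) seq_shift @^-1` cylinder xi)) <=
  C%:E * mu (cylinder w) * mu (cylinder xi).
Proof.
move=> cX C0 psiC.
have mA : measurable (iter (i + g) seq_shift @^-1` cylinder xi :
   set (seq_space X)) by exact: measurable_shift_cylinder.
set A := _ @^-1` _ in mA *.
have mwA : measurable (cylinder w `&` A : set (seq_space X)).
  exact: measurableI.
have wAw : mu (cylinder w `&` A) <= mu (cylinder w).
  by apply: le_measure; rewrite ?inE//; exact: subIsetl.
(* The supremum skips a null [w], but then both sides vanish. *)
have [w0|wn0] := eqVneq (mu (cylinder w)) 0.
  rewrite w0 mule0 mul0e -w0//.
have wgt0 : 0 < mu (cylinder w) by rewrite lt0e wn0/=.
have wfin : mu (cylinder w) \is a fin_num by exact: fin_num_measure.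
have xifin : mu (cylinder xi) \is a fin_num by exact: fin_num_measure.
have wAfin : mu (cylinder w `&` A) \is a fin_num by exact: fin_num_measure.
(* A vanishing joint measure may produce a discarded [0 / 0]; the bound is then trivial. *)
have [wA0|wAn0] := eqVneq (mu (cylinder w `&` A)) 0.
  by rewrite wA0 !mule_ge0.
have : cond_cyl mu A w / mu (cylinder xi) <= C%:E.
  apply: le_trans psiC; apply: ereal_sup_ubound; exists w, xi => /=.
  split => // -[+ _]; rewrite /cond_cyl setIC => /eqP.
  rewrite mule_eq0 (negbTE wAn0)/= inve_eq0 => /eqP wy.
  by rewrite wy in wfin.
rewrite /cond_cyl setIC.
move: wgt0 wAn0 wn0; rewrite -(fineK wfin) -(fineK xifin) -(fineK wAfin).
set p := fine _; set q := fine _; set r := fine _.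
rewrite lte_fin !eqe => p0 q0 pn0.
have {}q0 : (0 < q)%R by rewrite lt0r q0 fine_ge0.
have r0 : (0 <= r)%R by rewrite fine_ge0.
(* If [r], the measure of [xi], were 0, the ratio would be [+oo], against the finite bound [C]. *)
rewrite !inver (negbTE pn0); case: eqVneq => [_|rn0].
  by rewrite -EFinM gt0_muley ?lte_fin ?divr_gt0.
rewrite -!EFinM !lee_fin ler_pdivrMr ?lt0r ?rn0//.
by rewrite ler_pdivrMr// mulrAC.
Qed.

(** Each word splits into [w], a gap word and [xi]. With [w] and [xi] fixed, the gap word is summed
    out, and [psi_plus_bound] for each measure decouples [w] from [xi]. *)
Lemma divergence_gap_le mu nu g i j (C D : R) :
  countable [set: X] -> (0 <= C)%R -> (0 <= D)%R ->
  psi_plus mu g i j <= C%:E -> psi_plus nu g i j <= D%:E ->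
  divergence mu nu (i + (g + j)) <=
  (C * D)%:E * (divergence mu nu i * divergence mu nu j).
Proof.
move=> cX C0 D0 psiC psiD.
rewrite {1}/divergence esum_tuple_cat; last by move=> t; exact: mule_ge0.
apply: (@le_trans _ _ (\esum_(w in [set: i.-tuple X])
   (mu (cylinder w) * nu (cylinder w) *
     ((C * D)%:E * divergence mu nu j)))); last first.
  apply: le_trans (esum_mulr_le _ _ _) _.
  - by move=> w; exact: mule_ge0.
  - by rewrite mule_ge0// ?lee_fin ?mulr_ge0// divergence_ge0.
  - by rewrite muleCA.
apply: le_esum => w _.
rewrite esum_tuple_cat; last by move=> t; exact: mule_ge0.
(* The exchange makes the sum over gap words the innermost one. *)
rewrite esum_exchange; last by move=> *; exact: mule_ge0.
apply: (@le_trans _ _ (\esum_(xi in [set: j.-tuple X])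
   (mu (cylinder xi) * nu (cylinder xi) *
     (mu (cylinder w) * nu (cylinder w) * (C * D)%:E)))); last first.
  apply: le_trans (esum_mulr_le _ _ _) _.
  - by move=> xi; exact: mule_ge0.
  - by rewrite !mule_ge0// lee_fin mulr_ge0.
  - by rewrite muleC muleA.
apply: le_esum => xi _.
set A := cylinder w `&` (iter (i + g) seq_shift @^-1` cylinder xi).
apply: (@le_trans _ _ (mu A * nu A)).
  apply: esum_measureM_le => //.
  - move=> v v' _ _ [x []]; rewrite !cylinder_cat => -[_ [xv _]] [_ [xv' _]].
    exact: cylinder_inj xv xv'.
  - by apply: measurableI => //; exact: measurable_shift_cylinder.
  - move=> v x; rewrite !cylinder_cat => -[xw [_ xxi]]; split => //.
    by rewrite addnC /= iterD.
apply: (@le_trans _ _ ((C%:E * mu (cylinder w) * mu (cylinder xi)) *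
   (D%:E * nu (cylinder w) * nu (cylinder xi)))).
  by apply: lee_pmul => //; exact: psi_plus_bound.
by rewrite EFinM muleACA [X in X * _]muleACA [X in X * _]muleC muleC.
Qed.

End Divergence.

(** * Convergence criteria in the extended reals *)

Section ereal_limits.
Context {R : realType}.
Implicit Types (u : (\bar R)^nat) (x y : \bar R).

Lemma ereal_dense x y : x < y -> exists r : R, x < r%:E < y.
Proof.
move: x y => [r| |] [s| |]//; rewrite ?lte_fin => rs.
- by exists ((r + s) / 2)%R; rewrite !lte_fin; lra.
- by exists (r + 1)%R; rewrite lte_fin ltry; lra.
- by exists (s - 1)%R; rewrite lte_fin ltNyr; lra.
- by exists 0%R; rewrite ltNyr ltry.
Qed.

Lemma limn_einf_esup_cvg u : limn_esup u <= limn_einf u ->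
  u k @[k --> \oo] --> limn_esup u.
Proof.
move=> supinf; apply: (@squeeze_cvge _ _ _ _ (einfs u) _ (esups u)).
- apply: nearW => n; rewrite /einfs /esups/=; apply/andP; split.
    by apply: ereal_inf_lbound; exists n => /=.
  by apply: ereal_sup_ubound; exists n => /=.
- have -> : limn_esup u = limn_einf u.
    by apply/eqP; rewrite eq_le supinf limn_einf_sup.
  by rewrite limn_einf_lim; exact: is_cvg_einfs.
- by rewrite limn_esup_lim; exact: is_cvg_esups.
Qed.

(** If the lower limit were below the upper one, reals [c < c'] would fit strictly between them; [u]
    reaches [c'] infinitely often, so persistence would push the lower limit up to [c]. *)
Lemma persistent_cvg u :
  (forall c c' : R, (c < c')%R ->
    (forall N, exists2 m, (N <= m)%N & c'%:E <= u m) ->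
    \forall k \near \oo, c%:E <= u k) ->
  u k @[k --> \oo] --> limn_esup u.
Proof.
move=> persist; apply: limn_einf_esup_cvg; rewrite leNgt; apply/negP.
move=> /ereal_dense[c' /andP[+ c'sup]].
move=> /ereal_dense[c /andP[infc]]; rewrite lte_fin => cc'.
have [N|N _ uN] := persist _ _ cc'.
  have : c'%:E < esups u N.
    apply: (lt_le_trans c'sup); apply: ereal_inf_lbound.
    by exists [set k | (N <= k)%N] => //; exists N.
  by move=> /ereal_sup_gt[_ [m /= Nm <-]] /ltW; exists m.
move: infc; apply/negP; rewrite -leNgt limn_einf_lim.
have -> : limn (einfs u) = ereal_sup (range (einfs u)).
  by apply/cvg_lim => //; exact: cvg_einfs_sup.
apply: (@le_trans _ _ (einfs u N)); last by apply: ereal_sup_ubound; exists N.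
by apply: le_ereal_inf_tmp => _ [k /= Nk <-]; exact: uN.
Qed.

End ereal_limits.

(** * Extended logarithms in base [b] *)

Section loge_lemmas.
Context {R : realType}.
Variables (b : R) (hb : (1 < b)%R).

Lemma loge_EFin (r : R) : (0 < r)%R -> loge b r%:E = (ln r / ln b)%:E.
Proof. by move=> r0; rewrite /loge lne_EFin. Qed.

(** Beyond exponentiating, this shows that a finite bound on the logarithm excludes [x = +oo];
    applied to [psi_plus_max], it supplies the finite constants for [divergence_gap_le]. *)
Lemma loge_le (x : \bar R) (r : R) :
  loge b x <= r%:E -> x <= (expR (r * ln b))%:E.
Proof.
have lnb0 : (0 < ln b)%R by exact: ln_gt0.
case: x => [x| |]; rewrite ?leNye//; last first.
  by rewrite /loge/= gt0_mulye ?lte_fin ?invr_gt0.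
have [x0 _|x0] := leP x 0%R.
  by rewrite lee_fin (le_trans x0)// expR_ge0.
rewrite loge_EFin// !lee_fin ler_pdivrMr// => xr.
by rewrite -[leLHS]lnK ?posrE// ler_expR.
Qed.

End loge_lemmas.

Theorem theorem2p1 (R : realType) (b : R) (hb : (1 < b)%R)
    (X : pointedType) (countX : countable [set: X])
    (mu nu : probability (seq_space X) R) (g : nat)
    (hpsi : exists K eps : R, [/\ (0 < K)%R, (0 < eps)%R &
      forall i j : nat, (1 <= i)%N -> (1 <= j)%N ->
        loge b (psi_plus_max mu nu g i j) <=
        (K * ((i + j)%:R / (logb b (i + j)%:R `^ (1 + eps))))%:E]) :
  (exists2 L : \bar R, 0 <= L & rate b mu nu k @[k --> \oo] --> L) /\
  limn_einf (rate b mu nu) = limn_esup (rate b mu nu).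
Proof.
suff [L L0 rateL] : exists2 L, 0 <= L & rate b mu nu k @[k --> \oo] --> L.
  by split; [exists L|rewrite !(cvg_limn_einf_sup rateL)].
have [K [eps [K0 eps0 psiK]]] := hpsi.
have lnb0 : (0 < ln b)%R by exact: ln_gt0.
set E := divergence mu nu.
have Emono m n : (m <= n)%N -> E n <= E m.
  by move=> /subnKC <-; exact: divergence_addn_le.
(* Once [E] vanishes it stays 0 by monotonicity. Starting at [k0.+1] keeps [k] positive, so that the
   factor [k%:R^-1] does not take its default value 0. *)
have [[k0 Ek0]|En0] := pselect (exists k, E k = 0).
  exists +oo => //; apply: cvg_near_cst; exists k0.+1 => // k /= k0k.
  rewrite /rate; have -> : divergence mu nu k = 0.
    apply/eqP; rewrite eq_le divergence_ge0 andbT -Ek0.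
    by apply: Emono; exact: ltnW.
  rewrite /loge le0_lneNy// gt0_mulNye ?lte_fin ?invr_gt0//.
  by rewrite gt0_muleNy// lte_fin invr_gt0 ltr0n (leq_trans _ k0k).
have Efin k : E k \is a fin_num.
  by rewrite ge0_fin_numE ?divergence_ge0// (le_lt_trans (divergence_le1 _ _ _))// ltry.
pose p k := fine (E k).
have pE k : E k = (p k)%:E by rewrite fineK.
have p0 k : (0 < p k)%R.
  rewrite lt0r fine_ge0 ?divergence_ge0// andbT.
  by apply/eqP => pk0; apply: En0; exists k; rewrite pE pk0.
pose a k := (ln (p k) / ln b)%R.
have rateE k : rate b mu nu k = (- (k%:R^-1 * a k))%:E.
  by rewrite /rate -/(E k) pE loge_EFin.
have a0 k : (a k <= 0)%R.
  rewrite ler_pdivrMr// mul0r ln_le0// -lee_fin -pE.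
  exact: divergence_le1.
have amono : {homo a : m n / (m <= n)%N >-> (n <= m)%R}.
  move=> m n mn; rewrite ler_pM2r ?invr_gt0// ler_ln ?posrE//.
  by rewrite -lee_fin -!pE; exact: Emono.
(* The factor 2 counts the two measures, and the power of [ln b] converts the base [b] logarithm in
   the hypothesis into a natural one. *)
have asub i j : (1 <= i)%N -> (1 <= j)%N ->
    (a (i + (g + j))%N <= a i + a j + 2 * K * ln b `^ (1 + eps) *
      ((i + j)%:R * ln (i + j)%:R `^ (- (1 + eps))))%R.
  move=> i1 j1; have := loge_le hb (psiK i j i1 j1).
  set r := (K * _)%R; rewrite ge_max => /andP[psimu psinu].
  have c0 := expR_ge0 (r * ln b)%R.
  have := divergence_gap_le countX c0 c0 psimu psinu.
  rewrite -!/(E _) !pE -!EFinM lee_fin -expRD => ple.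
  have plog : (ln (p (i + (g + j))%N) <= r * ln b + r * ln b +
      (ln (p i) + ln (p j)))%R.
    rewrite -[X in (X + _)%R]expRK -!lnM ?posrE ?mulr_gt0 ?expR_gt0//.
    by rewrite ler_ln ?posrE// !mulr_gt0 ?expR_gt0.
  have ln_ij : (0 <= ln (i + j)%:R :> R)%R by rewrite ln_ge0// ler1n addn_gt0 i1.
  have -> : (2 * K * ln b `^ (1 + eps) *
      ((i + j)%:R * ln (i + j)%:R `^ (- (1 + eps))) = r + r)%R.
    rewrite /r /logb powRM ?invr_ge0 ?(ltW lnb0)//.
    rewrite -(powR_inv1 (ltW lnb0)) -powRrM mulN1r !powRN invfM invrK; ring.
  rewrite ler_pdivrMr// !mulrDl !divfK ?gt_eqF//.
  by move: plog; lra.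
have rate0 k : 0 <= rate b mu nu k.
  by rewrite rateE lee_fin oppr_ge0 mulr_ge0_le0// invr_ge0.
have cvg : rate b mu nu k @[k --> \oo] --> limn_esup (rate b mu nu).
  apply: persistent_cvg => c c' cc' freq.
  have K2 : (0 <= 2 * K * ln b `^ (1 + eps))%R.
    by rewrite !mulr_ge0 ?powR_ge0// ltW.
  have := gapped_rate_persists eps0 K2 amono a0 asub cc'.
  move=> /(_ _)[N|N _ aN].
    by have [m Nm] := freq N; rewrite rateE lee_fin; exists m.
  by exists N => // k /aN/=; rewrite rateE lee_fin.
exists (limn_esup (rate b mu nu)) => //.
by apply: (cvge_ge _ cvg); exact: nearW.
Qed.
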